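(* Let $E$ be a real Banach lattice. Every r-compact operator $T:E\to E$ is regularly quasi $KB$.
   Context: An operator $T:E\to E$ is r-compact if $T=T_1-T_2$ for some positive compact operators $T_1,T_2$ in $E$. A continuous linear operator $T:E\to E$ is quasi $KB$ if it takes norm-bounded increasing nets in $E_+$ to norm Cauchy nets. An operator $T$ is regularly quasi $KB$ if $T=T_1-T_2$ for some positive quasi $KB$ operators $T_1,T_2$ in $E$. *)

(* Defs.v *)
From HB Require Import structures.
From mathcomp Require Import all_boot all_order all_algebra.
From mathcomp Require Import all_classical all_reals all_analysis.

Set Implicit Arguments.
Unset Strict Implicit.
Unset Printing Implicit Defensive.

Import Order.TTheory GRing.Theory Num.Theory.
Import numFieldNormedType.Exports.

Local Open Scope classical_set_scope.
Local Open Scope ring_scope.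

Reserved Notation "x <=v y" (at level 70, y at next level, no associativity).

(* The order is carried by this mixin: HB does not allow joining [Order.Lattice]
   with [NormedModule] downstream of [Num.NumDomain]. *)
HB.mixin Record Lmodule_isRieszSpace (R : numDomainType) E
    of GRing.Lmodule R E := {
  vle : rel E ;
  vjoin : E -> E -> E ;
  vmeet : E -> E -> E ;
  vle_refl : reflexive vle ;
  vle_anti : antisymmetric vle ;
  vle_trans : transitive vle ;
  vleUx : forall x y z : E, vle (vjoin x y) z = vle x z && vle y z ;
  vlexI : forall x y z : E, vle z (vmeet x y) = vle z x && vle z y ;
  vleD2r : forall z x y : E, vle x y -> vle (x + z) (y + z) ;
  vscaler_ge0 : forall (a : R) (x : E), 0 <= a -> vle 0 x -> vle 0 (a *: x)
}.

#[short(type="rieszSpaceType")]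
HB.structure Definition RieszSpace (R : numDomainType) :=
  { E of Lmodule_isRieszSpace R E & GRing.Lmodule R E }.

Notation "x <=v y" := (vle x y) : ring_scope.

(* `|x| is the norm of x; this is the lattice modulus of x. *)
Definition modulus (R : numDomainType) (E : rieszSpaceType R) (x : E) : E :=
  vjoin x (- x).

HB.mixin Record CompleteNormedModule_RieszSpace_isBanachLattice
    (R : numFieldType) E of CompleteNormedModule R E & RieszSpace R E := {
  ler_norm_modulus :
    forall x y : E, modulus x <=v modulus y -> `|x| <= `|y|
}.

#[short(type="banachLatticeType")]
HB.structure Definition BanachLattice (R : numFieldType) :=
  { E of CompleteNormedModule_RieszSpace_isBanachLattice R E
       & CompleteNormedModule R E & RieszSpace R E }.

Section directed_nets.
Variables (I : Type) (le : I -> I -> Prop).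

Definition directed_preorder :=
  [/\ [set: I] !=set0, forall i, le i i,
      forall i j k, le i j -> le j k -> le i k
    & forall i j, exists2 k, le i k & le j k].

Definition net_filter : set_system I :=
  filter_from [set: I] (fun i => [set j | le i j]).

End directed_nets.

Section operators.
Variables (R : realType) (E : banachLatticeType R).
Implicit Types T : {linear E -> E}.

Definition positive_operator T := forall x : E, 0 <=v x -> 0 <=v T x.

Definition compact_operator T :=
  forall A : set E, bounded_set A -> precompact (T @` A).

Definition r_compact T :=
  exists T1 T2 : {linear E -> E},
    [/\ positive_operator T1 /\ compact_operator T1,
        positive_operator T2 /\ compact_operator T2
      & T =1 T1 \- T2].

(* "Increasing" is understood in the weak sense, as usual for nets. *)
Definition quasi_KB T :=
  continuous T /\
  forall (I : Type) (le : I -> I -> Prop) (x : I -> E),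
    directed_preorder le ->
    (forall i, 0 <=v x i) ->
    (forall i j, le i j -> x i <=v x j) ->
    bounded_set (range x) ->
    cauchy (T \o x @ net_filter le).

Definition regularly_quasi_KB T :=
  exists T1 T2 : {linear E -> E},
    [/\ positive_operator T1 /\ quasi_KB T1,
        positive_operator T2 /\ quasi_KB T2
      & T =1 T1 \- T2].

End operators.

(* Main.v *)
Require Import Defs.
From mathcomp Require Import all_boot all_order all_algebra.
From mathcomp Require Import all_classical all_reals all_analysis.

(** Write T = T1 - T2 with T1 and T2 positive and compact; it suffices that a
    positive compact operator S is quasi KB. Such an S maps bounded sets to
    precompact, hence bounded, sets, so it is continuous. If x is a bounded
    increasing net of positive vectors, then S x is an increasing net with
    precompact range, so it has a cluster point. The norm of a Banach lattice
    is monotone on the positive cone, and this turns a cluster point of an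
    increasing net into a limit: a term squeezed between two terms that are
    close to the cluster point is itself close to them. *)

Set Implicit Arguments.
Unset Strict Implicit.
Unset Printing Implicit Defensive.

Import Order.TTheory GRing.Theory Num.Theory.
Import numFieldNormedType.Exports.

Local Open Scope classical_set_scope.
Local Open Scope ring_scope.

Section riesz_space.
Variables (R : numDomainType) (E : rieszSpaceType R).
Implicit Types u v w : E.

Lemma vsub_ge0 u v : u <=v v -> 0 <=v v - u.
Proof. by move=> /(vleD2r (- u)); rewrite subrr. Qed.

Lemma vle_modulus v : v <=v modulus v.
Proof.
by have := vle_refl (modulus v); rewrite {1}/modulus vleUx => /andP[].
Qed.

Lemma modulus_ge0_le u v : 0 <=v u -> u <=v v -> modulus u <=v modulus v.
Proof.
move=> u0 uv; have uV : u <=v modulus v := vle_trans _ _ _ uv (vle_modulus v).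
rewrite [modulus u]/modulus vleUx uV /=.
have Nu0 : - u <=v 0 by have := vleD2r (- u) _ _ u0; rewrite add0r subrr.
exact: vle_trans _ _ _ Nu0 (vle_trans _ _ _ u0 uV).
Qed.

End riesz_space.

Section nets.
Variables (I : Type) (le : I -> I -> Prop).
Hypothesis dir : directed_preorder le.

Lemma net_filter_proper : ProperFilter (net_filter le).
Proof.
have [[i0 _] refl trans up] := dir.
apply: filter_from_proper; last by move=> i _; exists i; exact: refl.
apply: filter_from_filter; first by exists i0.
move=> i j _ _; have [k ik jk] := up i j.
by exists k => // l kl; split; [exact: trans ik kl | exact: trans jk kl].
Qed.

End nets.

Section banach_lattice.
Variables (R : realType) (E : banachLatticeType R).

Lemma ler_norm_ge0_le (u v : E) : 0 <=v u -> u <=v v -> `|u| <= `|v|.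
Proof. by move=> u0 uv; apply/ler_norm_modulus/modulus_ge0_le. Qed.

(** Given a term y j close to the cluster point p and any later k, clustering
    yields a term y m beyond k that is also close to p; since
    0 <= y k - y j <= y m - y j, the term y k is close to y j. *)
Lemma increasing_net_cluster_cauchy (I : Type) (le : I -> I -> Prop)
    (y : I -> E) (p : E) :
  directed_preorder le -> (forall i j, le i j -> y i <=v y j) ->
  cluster (y @ net_filter le) p -> cauchy (y @ net_filter le).
Proof.
move=> dir ymon clp; have PF := net_filter_proper dir.
have [[i0 _] refl _ _] := dir.
have near_p e i : 0 < e -> exists2 j, le i j & `|p - y j| < e.
  move=> e0; have [||_ [[j ij <-] pj]] := clp (y @` [set j | le i j]) (ball p e).
  - by exists i => // j ij; exists j.
  - exact: nbhsx_ballx.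
  by exists j => //; rewrite -ball_normE in pj.
apply: cauchy_exP => e e0.
have e20 : 0 < e / 2 by rewrite divr_gt0.
have [j _ pj] := near_p _ i0 e20.
exists (y j), j => // k jk /=.
have [m km pm] := near_p _ k e20.
rewrite -ball_normE /= distrC.
apply: (@le_lt_trans _ _ `|y m - y j|).
  by apply: ler_norm_ge0_le; [exact/vsub_ge0/ymon | exact/vleD2r/ymon].
rewrite [e in _ < e]splitr (le_lt_trans (ler_distD p _ _))// ltrD//.
by rewrite distrC.
Qed.

Lemma compact_operator_continuous (S : {linear E -> E}) :
  compact_operator S -> continuous S.
Proof.
move=> cS; apply/linear_bounded_continuous/bounded_funP => r.
have bA : bounded_set [set x : E | `|x| <= r].
  exists r; split; first exact: num_real.
  by move=> M rM x /= xr; rewrite (le_trans xr)// ltW.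
have := cS _ bA; rewrite precompactE => /compact_bounded /pinfty_ex_gt0[M _ SM].
by exists M => x xr; apply: SM; apply: subset_closure; exists x.
Qed.

Lemma positive_compact_quasi_KB (S : {linear E -> E}) :
  positive_operator S -> compact_operator S -> quasi_KB S.
Proof.
move=> S0 cS; split; first exact: compact_operator_continuous.
move=> I le x dir _ xmon bx; have PF := net_filter_proper dir.
have Smon i j : le i j -> S (x i) <=v S (x j).
  by move=> /xmon/vsub_ge0/S0/(vleD2r (S (x i))); rewrite linearB subrK add0r.
have := cS _ bx; rewrite precompactE.
move=> /(_ (S \o x @ net_filter le))[|p [_ clp]].
  have [[i0 _] _ _ _] := dir.
  by exists i0 => // i _; apply: subset_closure; exists (x i) => //; exists i.
exact: increasing_net_cluster_cauchy dir Smon clp.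
Qed.

End banach_lattice.

Theorem proposition4 (R : realType) (E : banachLatticeType R)
    (T : {linear E -> E}) :
  r_compact T -> regularly_quasi_KB T.
Proof.
move=> [T1 [T2 [[p1 c1] [p2 c2] TE]]].
by exists T1, T2; split=> //; split=> //; exact: positive_compact_quasi_KB.
Qed.
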